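(* $C_4 + P_1$ is proportionally $(2,3)$-choosable.
   Context: All graphs are nonempty, finite and simple. $C_n$ denotes the cycle on $n$ vertices, $P_n$ the path on $n$ vertices, and $G_1+G_2$ the disjoint union of vertex-disjoint graphs $G_1$ and $G_2$. For $m\in\mathbb{N}=\{1,2,3,\ldots\}$, $[m]=\{1,\ldots,m\}$. For integers $1\le k\le \ell$, a $(k,\ell)$-assignment for a graph $G$ is a function $L$ assigning to each vertex $v$ of $G$ a set $L(v)\subseteq[\ell]$ with $|L(v)|=k$. Let $\mathcal{L}=\bigcup_{v\in V(G)}L(v)$ and, for $c\in\mathcal{L}$, let $\eta(c)=|\{v\in V(G): c\in L(v)\}|$. A proportional $L$-coloring of $G$ is a function $f$ on $V(G)$ with $f(v)\in L(v)$ for every $v$, with $f(u)\ne f(v)$ whenever $u,v$ are adjacent, and with $|f^{-1}(c)|\in\{\lfloor \eta(c)/k\rfloor,\lceil \eta(c)/k\rceil\}$ for every $c\in\mathcal{L}$. $G$ is proportionally $(k,\ell)$-choosable if a proportional $L$-coloring of $G$ exists for every $(k,\ell)$-assignment $L$ for $G$. *)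

(* Defs.v *)
From mathcomp Require Import all_boot.

Set Implicit Arguments.
Unset Strict Implicit.
Unset Printing Implicit Defensive.

Record sgraph := SGraph {
  vertex :> finType;
  adj : rel vertex;
  adj_sym : symmetric adj;
  adj_irr : irreflexive adj;
  vertex_gt0 : 0 < #|vertex| }.

Section CyclePath.

Variable n : nat.

Definition cycle_adj (i j : 'I_n) : bool :=
  (j == i.+1 %% n :> nat) || (i == j.+1 %% n :> nat).

Lemma cycle_adj_sym : symmetric cycle_adj.
Proof. by move=> i j; rewrite /cycle_adj orbC. Qed.

Lemma cycle_adj_irr : 2 < n -> irreflexive cycle_adj.
Proof.
move=> n_gt2 i; rewrite /cycle_adj orbb; apply/negbTE/eqP.
have [lt_i1n | le_n_i1] := ltnP i.+1 n.
  by rewrite modn_small // => /n_Sn.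
have -> : i.+1 = n by apply/eqP; rewrite eqn_leq le_n_i1 ltn_ord.
by rewrite modnn => i0; rewrite i0 leqNgt (ltnW n_gt2) in le_n_i1.
Qed.

Lemma ord_gt2 : 2 < n -> 0 < #|'I_n|.
Proof. by rewrite card_ord => /ltnW/ltnW. Qed.

Definition cycle_graph (n_gt2 : 2 < n) : sgraph :=
  SGraph cycle_adj_sym (cycle_adj_irr n_gt2) (ord_gt2 n_gt2).

Definition path_adj (i j : 'I_n) : bool :=
  (j == i.+1 :> nat) || (i == j.+1 :> nat).

Lemma path_adj_sym : symmetric path_adj.
Proof. by move=> i j; rewrite /path_adj orbC. Qed.

Lemma path_adj_irr : irreflexive path_adj.
Proof. by move=> i; rewrite /path_adj orbb; apply/negbTE/eqP => /n_Sn. Qed.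

Lemma ord_gt0 : 0 < n -> 0 < #|'I_n|.
Proof. by rewrite card_ord. Qed.

Definition path_graph (n_gt0 : 0 < n) : sgraph :=
  SGraph path_adj_sym path_adj_irr (ord_gt0 n_gt0).

End CyclePath.

Section DisjointUnion.

Variables G H : sgraph.

Definition disjoint_union_adj (u v : G + H) : bool :=
  match u, v with
  | inl x, inl y => adj x y
  | inr x, inr y => adj x y
  | _, _ => false
  end.

Lemma disjoint_union_adj_sym : symmetric disjoint_union_adj.
Proof. by move=> [x|x] [y|y] //=; rewrite adj_sym. Qed.

Lemma disjoint_union_adj_irr : irreflexive disjoint_union_adj.
Proof. by move=> [x|x] /=; rewrite adj_irr. Qed.

Lemma disjoint_union_gt0 : 0 < #|{: G + H}|.
Proof. by rewrite card_sum addn_gt0 vertex_gt0. Qed.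

Definition disjoint_union : sgraph :=
  SGraph disjoint_union_adj_sym disjoint_union_adj_irr disjoint_union_gt0.

End DisjointUnion.

Definition ceil_divn (m k : nat) : nat := (m + k.-1) %/ k.

Lemma ceil_divn_leq (m k q : nat) :
  0 < k -> (ceil_divn m k <= q) = (m <= q * k).
Proof.
case: k => // k _; rewrite /ceil_divn /= -ltnS ltn_divLR // mulSn.
by rewrite addnC addSn ltnS leq_add2l.
Qed.

(* The colour i : 'I_l stands for the element i + 1 of [l] = {1, ..., l}.
   The notions below are meant for 1 <= k <= l. *)
Section ProportionalColoring.

Variables (G : sgraph) (k l : nat).

Definition assignment (L : G -> {set 'I_l}) : Prop := forall v, #|L v| = k.

Definition palette (L : G -> {set 'I_l}) : {set 'I_l} := \bigcup_(v : G) L v.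

Definition multiplicity (L : G -> {set 'I_l}) (c : 'I_l) : nat :=
  #|[set v | c \in L v]|.

Definition proportional_coloring (L : G -> {set 'I_l}) (f : G -> 'I_l) : Prop :=
  [/\ forall v, f v \in L v,
      forall u v, adj u v -> f u != f v
    & forall c, c \in palette L ->
        #|f @^-1: [set c]| = multiplicity L c %/ k \/
        #|f @^-1: [set c]| = ceil_divn (multiplicity L c) k].

Definition proportionally_choosable : Prop :=
  forall L, assignment L -> exists f, proportional_coloring L f.

End ProportionalColoring.

(* Main.v *)
(** A list of size 2 inside a palette of 3 colours is determined by the one
    colour that it omits, so an assignment is a word of length 5 over the
    colours, and so is a colouring: the statement is a finite search, carried
    out by computation over the [3 ^ 5] assignments. *)
Require Import Defs.
From mathcomp Require Import all_boot.

(** Cardinalities of finite sets do not reduce well under computation, while counts along an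
    explicit list do; this lemma passes from one to the other. *)
Lemma count_cardset (T : finType) (s : seq T) (P : pred T) :
  uniq s -> s =i predT -> #|[set v | P v]| = count P s.
Proof.
move=> s_uniq s_full; rewrite cardE -size_filter; apply: perm_size.
apply: uniq_perm; rewrite ?enum_uniq ?filter_uniq // => v.
by rewrite mem_enum inE mem_filter s_full andbT.
Qed.

Lemma setC1_of_card_pred (T : finType) (A : {set T}) :
  #|A|.+1 = #|T| -> exists c, A = [set~ c].
Proof.
move=> cardA; have /eqP/cards1P[c Ac] : #|~: A| = 1.
  by apply: (@addnI #|A|); rewrite cardsC addn1.
by exists c; rewrite -Ac setCK.
Qed.

Fixpoint words (T : Type) (s : seq T) (n : nat) : seq (seq T) :=
  if n is n'.+1 then [seq c :: w | c <- s, w <- words T s n'] else [:: [::]].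

Lemma mem_words (T : eqType) (s w : seq T) :
  {subset w <= s} -> w \in words T s (size w).
Proof.
elim: w => //= c w IHw sws; apply: allpairs_f; first by rewrite sws ?mem_head.
by apply: IHw => x xw; rewrite sws // inE xw orbT.
Qed.

Definition C4P1 : sgraph :=
  disjoint_union (@cycle_graph 4 isT) (@path_graph 1 isT).

(* Explicit enumerations, since [enum] does not compute. *)
Definition colours : seq 'I_3 :=
  [:: @Ordinal 3 0 isT; @Ordinal 3 1 isT; @Ordinal 3 2 isT].

Definition vertices : seq C4P1 :=
  [:: inl (@Ordinal 4 0 isT); inl (@Ordinal 4 1 isT);
      inl (@Ordinal 4 2 isT); inl (@Ordinal 4 3 isT);
      inr (@Ordinal 1 0 isT)].

Lemma mem_colours : colours =i predT.
Proof. by case=> [[|[|[|]]] i]. Qed.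

Lemma mem_vertices : vertices =i predT.
Proof. by case=> [[[|[|[|[|]]]] i] | [[|] i]]. Qed.

Lemma vertices_uniq : uniq vertices.
Proof. by []. Qed.

(** Letters are matched to vertices by position in [vertices]; the default colour is never reached
    on words of length 5. *)
Definition of_word (w : seq 'I_3) (v : C4P1) : 'I_3 :=
  nth (@Ordinal 3 0 isT) w (index v vertices).

Lemma of_word_map (m : C4P1 -> 'I_3) : of_word (map m vertices) =1 m.
Proof.
move=> v; have v_in : v \in vertices by rewrite mem_vertices.
by rewrite /of_word (nth_map v) ?index_mem // nth_index.
Qed.

Definition proper (f : C4P1 -> 'I_3) : bool :=
  all (fun u => all (fun v => adj u v ==> (f u != f v)) vertices) vertices.

(* [m] gives the colour omitted by each list. *)
Definition balanced (m f : C4P1 -> 'I_3) (c : 'I_3) : bool :=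
  let eta := count (fun v => c != m v) vertices in
  count (fun v => f v == c) vertices \in [:: eta %/ 2; ceil_divn eta 2].

Definition proportional (m f : C4P1 -> 'I_3) : bool :=
  all (fun v => f v != m v) vertices && all (balanced m f) colours.

(** The proper colourings are the same for all assignments, so they are filtered once: 18 colourings
    of the cycle times 3 for the isolated vertex leave 54 candidates. *)
Lemma word_search :
  let ws := words 'I_3 colours 5 in
  let ps := [seq w <- ws | proper (of_word w)] in
  all (fun a => has (fun w => proportional (of_word a) (of_word w)) ps) ws.
Proof. by vm_compute. Qed.

Theorem proposition17 :
  proportionally_choosable
    (disjoint_union (@cycle_graph 4 isT) (@path_graph 1 isT)) 2 3.
Proof.
rewrite -/C4P1 => L cardL.
have /fin_all_exists[m Lm] : forall v, exists c, L v = [set~ c].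
  by move=> v; apply: setC1_of_card_pred; rewrite cardL card_ord.
have a_in : map m vertices \in words 'I_3 colours 5.
  by rewrite (_ : 5 = size (map m vertices)) // mem_words // => c _;
     rewrite mem_colours.
have /hasP[w] := allP word_search _ a_in.
rewrite mem_filter => /andP[/allP w_proper _] /andP[/allP w_list /allP w_prop].
exists (of_word w); split=> [v|u v|c _].
- by rewrite Lm !inE -[m v]of_word_map w_list ?mem_vertices.
- apply/implyP; have /allP := w_proper u (mem_vertices u).
  by apply; rewrite mem_vertices.
(* The search speaks of counts for the decoded word of [m]; both cardinalities in the goal are
   rewritten into that form. *)
have := w_prop c (mem_colours c); rewrite /balanced.
have -> : multiplicity L c
    = count (fun v => c != of_word (map m vertices) v) vertices.
  rewrite -(count_cardset _ _ _ vertices_uniq mem_vertices) /multiplicity.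
  by apply: eq_card => v; rewrite !inE Lm !inE of_word_map.
have -> : #|of_word w @^-1: [set c]| = count (fun v => of_word w v == c) vertices.
  rewrite -(count_cardset _ _ _ vertices_uniq mem_vertices).
  by apply: eq_card => v; rewrite !inE.
by rewrite !inE => /orP[] /eqP->; [left | right].
Qed.
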